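(* Let $\mathbf{A}$ be a real $m\times n$ matrix with columns $A_1,\ldots,A_n$ and $\mathrm{rank}(\mathbf{A})=1$, and let $\mathbf{A}=\mathbf{U}\mathbf{\Sigma}\mathbf{V}^T$ be a thin SVD. Then for any $c\geq 1$ and any $c$ (not necessarily distinct) columns $A_{t_1},\ldots,A_{t_c}$ with $A_{t_j}\neq 0$ for $1\leq j\leq c$, $$\sum_{j=1}^c w_j\,A_{t_j}A_{t_j}^T=\mathbf{A}\mathbf{A}^T\qquad\text{where}\quad w_j=\frac{1}{c\,\|\mathbf{V}^Te_{t_j}\|_2^2}=\frac{\|\mathbf{A}\|_F^2}{c\,\|A_{t_j}\|_2^2},\quad 1\leq j\leq c.$$
   Context: The thin SVD of a real $m\times n$ matrix $\mathbf{A}$ of rank $k$ is $\mathbf{A}=\mathbf{U}\mathbf{\Sigma}\mathbf{V}^T$, where $\mathbf{U}$ ($m\times k$) and $\mathbf{V}$ ($n\times k$) have orthonormal columns and $\mathbf{\Sigma}$ is the $k\times k$ diagonal matrix of the non-zero singular values $\sigma_1\geq\cdots\geq\sigma_k>0$ (here $k=1$). The vectors $e_1,\ldots,e_n$ are the columns of $\mathbf{I}_n$; $\|\cdot\|_2$ is the Euclidean (two-)norm and $\|\cdot\|_F$ the Frobenius norm. *)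

(* Defs.v *)
From mathcomp Require Import all_boot all_order all_algebra.

Set Implicit Arguments.
Unset Strict Implicit.
Unset Printing Implicit Defensive.

Import Order.TTheory GRing.Theory Num.Theory.

Local Open Scope ring_scope.

Definition norm2 (R : rcfType) (n : nat) (x : 'cV[R]_n) : R :=
  Num.sqrt (\sum_(i < n) x i 0 ^+ 2).

Definition normF (R : rcfType) (m n : nat) (A : 'M[R]_(m, n)) : R :=
  Num.sqrt (\sum_(i < m) \sum_(j < n) A i j ^+ 2).

Definition orthonormal_cols (R : rcfType) (m k : nat) (U : 'M[R]_(m, k)) : Prop :=
  U^T *m U = 1%:M.

Definition e_ (R : rcfType) (n : nat) (i : 'I_n) : 'cV[R]_n := col i 1%:M.
Arguments e_ {R n} i.

(* The positive diagonal entries of S are then the non-zero singular values of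
   A, and k is necessarily equal to \rank A. *)
Record thin_svd (R : rcfType) (m n k : nat) (A : 'M[R]_(m, n))
    (U : 'M[R]_(m, k)) (S : 'M[R]_k) (V : 'M[R]_(n, k)) : Prop := ThinSvd {
  svd_left : orthonormal_cols U;
  svd_right : orthonormal_cols V;
  svd_diag : is_diag_mx S;
  svd_pos : forall i : 'I_k, 0 < S i i;
  svd_sorted : forall i j : 'I_k, (i <= j)%N -> S j j <= S i i;
  svd_eq : A = U *m S *m V^T
}.

(* Main.v *)
Require Import Defs.
From mathcomp Require Import all_boot all_order all_algebra.

(** For a rank-one thin SVD the matrix [S] and each vector [V^T e_j] are 1 x 1,
    that is, scalars [s] and [v_j]. Hence the [j]-th column of [A] is
    [v_j *: (U *m S)], so all columns are parallel, and its outer product is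
    [v_j ^+ 2 *: (A *m A^T)], because [A *m A^T = (U *m S) *m (U *m S)^T] when
    the columns of [V] are orthonormal ([col_outer_rank1]). One selected column
    thus already determines [A *m A^T], and the sum in the theorem averages [c]
    copies of it.

    Both squared norms are traces of Gram matrices, so the trace of this
    identity gives [norm2 (col j A) ^+ 2 = v_j ^+ 2 * normF A ^+ 2], which
    relates the two expressions of the weights. The divisions are legitimate
    because [v_j != 0] follows from [col j A != 0], and because
    [normF A ^+ 2 = s ^+ 2 > 0] ([normF_rank1]). *)

Set Implicit Arguments.
Unset Strict Implicit.
Unset Printing Implicit Defensive.

Import Order.TTheory GRing.Theory Num.Theory.

Local Open Scope ring_scope.

Lemma normF_sqr (R : rcfType) (m n : nat) (A : 'M[R]_(m, n)) :
  normF A ^+ 2 = \tr (A *m A^T).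
Proof.
rewrite sqr_sqrtr; last first.
  by apply: sumr_ge0 => i _; apply: sumr_ge0 => j _; apply: sqr_ge0.
apply: eq_bigr => i _; rewrite mxE; apply: eq_bigr => j _.
by rewrite mxE expr2.
Qed.

Lemma norm2_normF (R : rcfType) (n : nat) (x : 'cV[R]_n) : norm2 x = normF x.
Proof.
by congr Num.sqrt; apply: eq_bigr => i _; rewrite big_ord1.
Qed.

Lemma norm2_sqr (R : rcfType) (n : nat) (x : 'cV[R]_n) :
  norm2 x ^+ 2 = \tr (x *m x^T).
Proof. by rewrite norm2_normF normF_sqr. Qed.

Lemma norm2_sqr1 (R : rcfType) (x : 'cV[R]_1) : norm2 x ^+ 2 = x 0 0 ^+ 2.
Proof. by rewrite norm2_sqr trace_mx11 mxE big_ord1 mxE expr2. Qed.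

(** The factor [V^T *m V] that appears in the middle of [A *m A^T] is 1. *)
Lemma svd_gram (R : rcfType) (m n k : nat) (A : 'M[R]_(m, n))
    (U : 'M[R]_(m, k)) (S : 'M[R]_k) (V : 'M[R]_(n, k)) :
  thin_svd A U S V -> A *m A^T = (U *m S) *m (U *m S)^T.
Proof.
case=> _ VtV _ _ _ ->.
by rewrite [(_ *m V^T)^T]trmx_mul trmxK -mulmxA (mulmxA V^T) VtV mul1mx.
Qed.

Lemma svd_col (R : rcfType) (m n k : nat) (A : 'M[R]_(m, n))
    (U : 'M[R]_(m, k)) (S : 'M[R]_k) (V : 'M[R]_(n, k)) (j : 'I_n) :
  thin_svd A U S V -> col j A = (U *m S) *m (V^T *m e_ j).
Proof. by case=> _ _ _ _ _ ->; rewrite /e_ mulmxA !colE mul1mx. Qed.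

(** With [k = 1], the coordinate vector [V^T *m e_ j] is a scalar, so it comes
    out of the outer product squared. *)
Lemma col_outer_rank1 (R : rcfType) (m n : nat) (A : 'M[R]_(m, n))
    (U : 'M[R]_(m, 1)) (S : 'M[R]_1) (V : 'M[R]_(n, 1)) (j : 'I_n) :
  thin_svd A U S V ->
  col j A *m (col j A)^T = norm2 (V^T *m e_ j) ^+ 2 *: (A *m A^T).
Proof.
move=> svdA; rewrite (svd_gram svdA) (svd_col j svdA) norm2_sqr1.
set v := V^T *m _; rewrite [v in LHS]mx11_scalar mul_mx_scalar.
by rewrite linearZ /= -scalemxAl -scalemxAr scalerA expr2.
Qed.

(** Cyclicity of the trace cancels [U], leaving the single singular value. *)
Lemma normF_rank1 (R : rcfType) (m n : nat) (A : 'M[R]_(m, n))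
    (U : 'M[R]_(m, 1)) (S : 'M[R]_1) (V : 'M[R]_(n, 1)) :
  thin_svd A U S V -> normF A ^+ 2 = S 0 0 ^+ 2.
Proof.
move=> svdA; rewrite normF_sqr (svd_gram svdA) mxtrace_mulC trmx_mul.
rewrite -mulmxA (mulmxA U^T) (svd_left svdA) mul1mx.
by rewrite trace_mx11 mxE big_ord1 mxE expr2.
Qed.

Theorem corollary2p3 (R : rcfType) (m n : nat) (A : 'M[R]_(m, n))
    (U : 'M[R]_(m, 1)) (S : 'M[R]_1) (V : 'M[R]_(n, 1))
    (hrank : \rank A = 1%N) (hsvd : thin_svd A U S V)
    (c : nat) (hc : (1 <= c)%N) (t : 'I_c -> 'I_n)
    (ht : forall j : 'I_c, col (t j) A != 0) :
  let w (j : 'I_c) : R := 1 / (c%:R * norm2 (V^T *m e_ (t j)) ^+ 2) in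
  (forall j : 'I_c, w j = normF A ^+ 2 / (c%:R * norm2 (col (t j) A) ^+ 2)) /\
  \sum_(j < c) w j *: (col (t j) A *m (col (t j) A)^T) = A *m A^T.
Proof.
move=> w.
have c_neq0 : c%:R != 0 :> R by rewrite pnatr_eq0 -lt0n.
have F_neq0 : normF A ^+ 2 != 0.
  by rewrite (normF_rank1 hsvd) expf_neq0 // gt_eqF // (svd_pos hsvd).
have v_neq0 j : norm2 (V^T *m e_ (t j)) ^+ 2 != 0.
  apply: contra (ht j); rewrite norm2_sqr1 sqrf_eq0 => /eqP v0.
  by rewrite (svd_col _ hsvd) [V^T *m _]mx11_scalar v0 mul_mx_scalar scale0r.
split=> [j|].
  rewrite /w (norm2_sqr (col _ _)) (col_outer_rank1 _ hsvd).
  rewrite mxtraceZ -normF_sqr div1r mulrA.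
  by rewrite [in RHS]invfM [RHS]mulrCA mulfV // mulr1.
under eq_bigr => j _.
  rewrite (col_outer_rank1 _ hsvd) scalerA /w div1r invfM mulfVK //.
  over.
by rewrite sumr_const card_ord -scaler_nat scalerA mulfV // scale1r.
Qed.
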